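(* Let $L,M,N$ be positive integers and let $g:=\{g_l\}_{l\in\mathbb{N}_L}$ and $h:=\{h_l\}_{l\in\mathbb{N}_L}$ be families in $\ell^2(\mathbb{Z}\times\mathbb{Z},\mathbb{R})$. Then the following statements are equivalent: 1. $\mathcal{G}(g,L,M,N)$ and $\mathcal{G}(h,L,M,N)$ are dual. 2. For all $k\in\mathbb{N}_N^2$ and $p\in\mathbb{Z}^2$, $$\left(\sum_{l\in\mathbb{N}_L}\mathcal{M}_{g_l}(k)\mathcal{M}_{h_l}^t(k)\right)_{0_{\mathbb{Z}^2},p}=\frac{1}{M^2}\chi_{\{0_{\mathbb{Z}^2}\}}(p).$$
   Context: $\mathbb{H}$ is the algebra of real quaternions with imaginary units $i,j,ij$. For a positive integer $K$, $\mathbb{N}_K:=\{0,1,\dots,K-1\}$. $\ell^2(\mathbb{Z}\times\mathbb{Z},\mathbb{H})$ is the right quaternionic Hilbert space of functions $f:\mathbb{Z}^2\to\mathbb{H}$ with $\sum_{k\in\mathbb{Z}^2}|f(k)|^2<\infty$, with inner product $\langle f,\phi\rangle=\sum_{k\in\mathbb{Z}^2}\overline{f(k)}\,\phi(k)$; $\ell^2(\mathbb{Z}\times\mathbb{Z},\mathbb{R})$ is the subset of real-valued ones. For $n=(n_1,n_2)\in\mathbb{Z}^2$, $(T_{nN}f)(k)=f(k-nN)$ where $nN=(n_1N,n_2N)$. For $m=(m_1,m_2)\in\mathbb{N}_M^2$, $(E_{\frac mM}f)(k)=e^{2\pi i\frac{m_1}{M}k_1}f(k)e^{2\pi j\frac{m_2}{M}k_2}$,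 $k=(k_1,k_2)\in\mathbb{Z}^2$. The Gabor system is $\mathcal{G}(g,L,M,N):=\{E_{\frac mM}T_{nN}g_l\}_{l\in\mathbb{N}_L,\,m\in\mathbb{N}_M^2,\,n\in\mathbb{Z}^2}$. The systems $\mathcal{G}(g,L,M,N)$ and $\mathcal{G}(h,L,M,N)$ are dual if for all $f,\phi\in\ell^2(\mathbb{Z}\times\mathbb{Z},\mathbb{H})$, $$\langle f,\phi\rangle=\sum_{l\in\mathbb{N}_L}\sum_{n\in\mathbb{Z}^2}\sum_{m\in\mathbb{N}_M^2}\langle f,E_{\frac mM}T_{nN}g_l\rangle\langle E_{\frac mM}T_{nN}h_l,\phi\rangle.$$ For $u\in\ell^2(\mathbb{Z}\times\mathbb{Z},\mathbb{H})$ and $k\in\mathbb{Z}^2$, $\mathcal{M}_u(k)$ is the matrix indexed by $\mathbb{Z}^2\times\mathbb{Z}^2$ with entries $(\mathcal{M}_u(k))_{p,n}=u(k+pM-nN)$, $p,n\in\mathbb{Z}^2$; $^t$ denotes transpose, so $(\mathcal{M}_{g_l}(k)\mathcal{M}_{h_l}^t(k))_{0_{\mathbb{Z}^2},p}=\sum_{n\in\mathbb{Z}^2}g_l(k-nN)h_l(k+pM-nN)$. $0_{\mathbb{Z}^2}=(0,0)$ and $\chi_E$ is the indicator function of $E$.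
   Formalization: Added assumption: for all f, φ in ℓ² and each l, the series over n∈Z² in the duality identity converges absolutely (duality is read to include this); without it statement 2 does not imply 1, e.g. for L=M=N=1 with Taylor coefficients of (1-z)^(∓1/4). *)

(* Defs.v *)
(* MathComp / MathComp-Analysis, over an arbitrary realType R. *)
From HB Require Import structures.
From mathcomp Require Import all_boot all_order all_algebra.
From mathcomp Require Import all_classical all_reals all_analysis.
From mathcomp Require Import ring.

Set Implicit Arguments.
Unset Strict Implicit.
Unset Printing Implicit Defensive.

Import Order.TTheory GRing.Theory Num.Theory.

Local Open Scope classical_set_scope.
Local Open Scope ring_scope.

(* Quat a b c d is a + b i + c j + d ij. *)
Record quat (R : realType) := Quat { qre : R; qi : R; qj : R; qk : R }.

Section QuaternionRing.
Variable R : realType.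
Local Notation H := (quat R).
Implicit Types x y z : H.

Definition quat_to_prod x : (R * R) * (R * R) := ((qre x, qi x), (qj x, qk x)).
Definition prod_to_quat (t : (R * R) * (R * R)) : H :=
  Quat t.1.1 t.1.2 t.2.1 t.2.2.

Lemma quat_to_prodK : cancel quat_to_prod prod_to_quat.
Proof. by case. Qed.

HB.instance Definition _ := Choice.copy H (can_type quat_to_prodK).

Definition qadd x y : H :=
  Quat (qre x + qre y) (qi x + qi y) (qj x + qj y) (qk x + qk y).
Definition qopp x : H := Quat (- qre x) (- qi x) (- qj x) (- qk x).

Definition qmul x y : H :=
  Quat (qre x * qre y - qi x * qi y - qj x * qj y - qk x * qk y)
       (qre x * qi y + qi x * qre y + qj x * qk y - qk x * qj y)
       (qre x * qj y - qi x * qk y + qj x * qre y + qk x * qi y)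
       (qre x * qk y + qi x * qj y - qj x * qi y + qk x * qre y).

Definition qreal (a : R) : H := Quat a 0 0 0.

Lemma qaddA : associative qadd.
Proof. by move=> [? ? ? ?] [? ? ? ?] [? ? ? ?]; congr Quat => /=; ring. Qed.

Lemma qaddC : commutative qadd.
Proof. by move=> [? ? ? ?] [? ? ? ?]; congr Quat => /=; ring. Qed.

Lemma qadd0 : left_id (qreal 0) qadd.
Proof. by move=> [? ? ? ?]; rewrite /qadd /= !add0r. Qed.

Lemma qaddN : left_inverse (qreal 0) qopp qadd.
Proof. by move=> [? ? ? ?]; rewrite /qadd /= !addNr. Qed.

HB.instance Definition _ := GRing.isZmodule.Build H qaddA qaddC qadd0 qaddN.

Lemma qmulA : associative qmul.
Proof. by move=> [? ? ? ?] [? ? ? ?] [? ? ? ?]; congr Quat => /=; ring. Qed.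

Lemma qmul1 : left_id (qreal 1) qmul.
Proof. by move=> [? ? ? ?]; rewrite /qmul /=; congr Quat; ring. Qed.

Lemma qmulr1 : right_id (qreal 1) qmul.
Proof. by move=> [? ? ? ?]; rewrite /qmul /=; congr Quat; ring. Qed.

Lemma qmulDl : left_distributive qmul qadd.
Proof. by move=> [? ? ? ?] [? ? ? ?] [? ? ? ?]; congr Quat => /=; ring. Qed.

Lemma qmulDr : right_distributive qmul qadd.
Proof. by move=> [? ? ? ?] [? ? ? ?] [? ? ? ?]; congr Quat => /=; ring. Qed.

Lemma quat1_neq0 : qreal 1 != 0 :> H.
Proof. by apply/eqP => -[] /eqP; rewrite oner_eq0. Qed.

HB.instance Definition _ := GRing.Zmodule_isNzRing.Build H
  qmulA qmul1 qmulr1 qmulDl qmulDr quat1_neq0.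

Definition qconj x : H := Quat (qre x) (- qi x) (- qj x) (- qk x).

Definition qabs x : R :=
  Num.sqrt (qre x ^+ 2 + qi x ^+ 2 + qj x ^+ 2 + qk x ^+ 2).

(* e^{i t} and e^{j t}, by Euler's formula *)
Definition expi (t : R) : H := Quat (cos t) (sin t) 0 0.
Definition expj (t : R) : H := Quat (cos t) 0 (sin t) 0.

End QuaternionRing.

Notation Z2 := (int * int)%type.
Notation N2 K := ('I_K * 'I_K)%type.

Definition N2_to_Z2 (K : nat) (k : N2 K) : Z2 := (Posz k.1, Posz k.2).

Section Series.
Variable R : realType.

Definition qsummable (x : Z2 -> quat R) : Prop :=
  summable [set: Z2] (fun n => (qabs (x n))%:E).

(* Unordered sums over Z^2: positive part minus negative part, in each
   component.  These are the usual sums for absolutely summable families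
   and carry no meaning otherwise. *)
Definition rsum (x : Z2 -> R) : R :=
  fine (\esum_(n in [set: Z2]) (Num.max (x n) 0)%:E) -
  fine (\esum_(n in [set: Z2]) (Num.max (- x n) 0)%:E).

Definition qsum (x : Z2 -> quat R) : quat R :=
  Quat (rsum (fun n => qre (x n))) (rsum (fun n => qi (x n)))
       (rsum (fun n => qj (x n))) (rsum (fun n => qk (x n))).

Definition l2 (f : Z2 -> quat R) : Prop :=
  summable [set: Z2] (fun k => (qabs (f k) ^+ 2)%:E).

Definition l2_real (f : Z2 -> quat R) : Prop :=
  l2 f /\ forall k, exists a : R, f k = qreal a.

Definition inner (f phi : Z2 -> quat R) : quat R :=
  qsum (fun k => qconj (f k) * phi k).

End Series.

Section Gabor.
Variable R : realType.
Implicit Types f phi u : Z2 -> quat R.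

Definition translation (N : nat) (n : Z2) f : Z2 -> quat R :=
  fun k => f (k - n *+ N).

Definition modulation (M : nat) (m : N2 M) f : Z2 -> quat R :=
  fun k => expi (2 * pi * ((m.1 : nat)%:R / M%:R) * k.1%:~R) * f k *
           expj (2 * pi * ((m.2 : nat)%:R / M%:R) * k.2%:~R).

Definition gabor (L M N : nat) (g : 'I_L -> Z2 -> quat R)
    (l : 'I_L) (n : Z2) (m : N2 M) : Z2 -> quat R :=
  modulation m (translation N n (g l)).

Definition gabor_term (L M N : nat) (g h : 'I_L -> Z2 -> quat R) f phi
    (l : 'I_L) (n : Z2) : quat R :=
  \sum_(m : N2 M) inner f (gabor N g l n m) * inner (gabor N h l n m) phi.

(* The sums over n in Z^2 in the duality identity converge, so that its
   right-hand side is defined for all f and phi in l2.  This is implied by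
   both systems being Bessel sequences, and can fail for general windows. *)
Definition gabor_series_converge (L M N : nat)
    (g h : 'I_L -> Z2 -> quat R) : Prop :=
  forall f phi, l2 f -> l2 phi ->
  forall l : 'I_L, qsummable (gabor_term M N g h f phi l).

Definition dual_gabor (L M N : nat) (g h : 'I_L -> Z2 -> quat R) : Prop :=
  gabor_series_converge M N g h /\
  forall f phi, l2 f -> l2 phi ->
    inner f phi = \sum_(l < L) qsum (gabor_term M N g h f phi l).

Definition imx := Z2 -> Z2 -> quat R.

Definition imx_mul (A B : imx) : imx := fun p q => qsum (fun n => A p n * B n q).

Definition imx_tr (A : imx) : imx := fun p q => A q p.

Definition gabor_mx (M N : nat) u (k : Z2) : imx :=
  fun p n => u (k + p *+ M - n *+ N).

End Gabor.

(* Main.v *)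
(* Summing over the modulations m kills all pairs of points of Z^2 that are not
   congruent modulo M, so on point masses at k and k + pM the right-hand side
   of the duality identity is M^2 times the entry (0, p) of the matrix product
   at k, and that entry is N-periodic in k.  Hence the matrix condition says
   exactly that duality holds for point masses.

   To pass to all f and phi in l2 one argument at a time, let D be the
   difference of the two sides as a functional of phi: it is linear on l2 and
   vanishes on finitely supported sequences, but it is not known to be
   continuous; only the terms of the series over n are.  If D phi <> 0, choose
   cut-offs K_0 < K_1 < ... and consider the weight
   w(k) = #{i | K_i <= k}.  Each tail of phi has the same D phi, so the partial
   sums of the series at w phi reach about j D phi when the cut-offs increase
   fast enough, while w phi is still in l2: this contradicts convergence. *)
Require Import Defs.
From mathcomp Require Import all_boot all_order all_algebra.
From mathcomp Require Import all_classical all_reals all_analysis.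
From mathcomp Require Import ring lra.

Import Order.TTheory GRing.Theory Num.Theory.
Import numFieldNormedType.Exports.
Local Open Scope ring_scope.

(** * Real series, and exchange of summation by a gliding hump *)

Section RealSeries.
Local Set Implicit Arguments.
Local Unset Strict Implicit.
Local Open Scope classical_set_scope.

Lemma series_nneg_bounded (R : realType) (u : R^nat) :
  (forall k, 0 <= u k) -> cvgn (series u) ->
  forall n, \sum_(0 <= k < n) u k <= limn (series u).
Proof.
move=> u0 cu n; apply: (nondecreasing_cvgn_le _ cu) => a b ab.
exact: nondecreasing_series.
Qed.

(** The cut-off can be taken past any given [K], which lets the cut-offs of the gliding hump
    increase strictly. *)
Lemma series_nneg_tail (R : realType) (u : R^nat) (K : nat) (e : R) :
  (forall k, 0 <= u k) -> cvgn (series u) -> 0 < e ->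
  exists K', (K < K')%N /\ forall n, \sum_(K' <= k < n) u k <= e.
Proof.
move=> u0 cu e0.
have /cvgrPdist_le/(_ e e0)[K1 _ HK] : series u @ \oo --> limn (series u) by [].
exists (maxn K K1).+1; split; first by rewrite ltnS leq_maxl.
set K' := (maxn K K1).+1 => n.
have [nK|Kn] := leqP n K'; first by rewrite big_geq// ltW.
have -> : \sum_(K' <= k < n) u k = series u n - series u K'.
  by rewrite sub_series_geq// ltnW.
have := HK K'; rewrite /= ler_norml => /(_ (leqW (leq_maxr _ _)))/andP[_].
have : series u n <= limn (series u) by exact: series_nneg_bounded.
lra.
Qed.

Lemma is_cvg_series_le (R : realType) (u v : R^nat) :
  (forall k, 0 <= u k <= v k) -> cvgn (series v) -> cvgn (series u).
Proof.
move=> uv; apply: series_le_cvg => n; have /andP[u0 uvn] := uv n => //.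
exact: le_trans uvn.
Qed.

Lemma eq_is_cvg_series (R : realType) (u v : R^nat) :
  u =1 v -> cvgn (series u) -> cvgn (series v).
Proof. by move=> /funext ->. Qed.

Lemma nondecreasing_homo (R : realType) (u : R^nat) :
  (forall k, u k <= u k.+1) -> forall m n, (m <= n)%N -> u m <= u n.
Proof. by move=> uS; apply/nondecreasing_seqP. Qed.

Lemma lim_series_mulDl (R : realType) (w1 w2 x : R^nat) :
  cvgn (series (fun k => w1 k * x k)) -> cvgn (series (fun k => w2 k * x k)) ->
  limn (series (fun k => (w1 k + w2 k) * x k)) =
  limn (series (fun k => w1 k * x k)) + limn (series (fun k => w2 k * x k)).
Proof.
move=> c1 c2; rewrite -lim_seriesD//; congr (limn (series _)).
by apply/funext => k; rewrite mulrDl.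
Qed.

Lemma series_eventually0 (R : realType) (u : R^nat) (K : nat) :
  (forall k, (K <= k)%N -> u k = 0) ->
  series u @ \oo --> \sum_(0 <= k < K) u k.
Proof.
move=> u0; apply: cvg_near_cst; exists K => // n /= Kn.
rewrite /series /= (big_cat_nat (leq0n _) Kn)/= [X in _ + X]big_nat_cond.
by rewrite [X in _ + X]big1 ?addr0// => i /andP[/andP[Ki _] _]; exact: u0.
Qed.

Section GlidingHump.
Variables (R : realType) (a : nat -> R^nat) (d v : R^nat).

(** In the application [v k] is the squared modulus of [phi k], so a good weight is one for which
    [w phi] stays in l2, and [a n k] is the contribution of the point [k] to the term of index
    [n]. *)
Let good (w : R^nat) :=
  (forall k, 0 <= w k) /\ cvgn (series (fun k => w k ^+ 2 * v k)).
Let S (w : R^nat) n := limn (series (fun k => w k * a n k)).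
Let D (w : R^nat) := limn (series (fun k => w k * d k)).
Let defect w := limn (series (S w)) - D w.

Hypothesis v_ge0 : forall k, 0 <= v k.
Hypothesis v_cvg : cvgn (series v).
Hypothesis good_cvg : forall w, good w ->
  [/\ forall n, cvgn (series (fun k => `|w k * a n k|)),
      cvgn (series (S w)) & cvgn (series (fun k => `|w k * d k|))].
Hypothesis a_cvg : forall k, series (a^~ k) @ \oo --> d k.

Let goodD w1 w2 : good w1 -> good w2 -> good (fun k => w1 k + w2 k).
Proof.
move=> [p1 c1] [p2 c2]; split; first by move=> k; rewrite addr_ge0.
pose t k := 2 * (w1 k ^+ 2 * v k) + 2 * (w2 k ^+ 2 * v k).
apply: (@is_cvg_series_le _ _ t) => [k|].
  have := v_ge0 k; have := p1 k; have := p2 k; rewrite /t.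
  have := sqr_ge0 (w1 k - w2 k) => ? ? ? ?.
  apply/andP; split; first by rewrite mulr_ge0// sqr_ge0.
  rewrite -subr_ge0 [leRHS](_ : _ = (w1 k - w2 k) ^+ 2 * v k); last by ring.
  by rewrite mulr_ge0.
have -> : t = 2 *: (fun k => w1 k ^+ 2 * v k) + 2 *: (fun k => w2 k ^+ 2 * v k).
  by apply/funext.
by apply: is_cvg_seriesD; apply: is_cvg_seriesZ.
Qed.

Let good_is_cvg w : good w ->
  (forall n, cvgn (series (fun k => w k * a n k))) /\
  cvgn (series (fun k => w k * d k)).
Proof.
by move=> /good_cvg[ca _ cd]; split=> [n|]; apply: normed_cvg => //; exact: ca.
Qed.

Let good_bounded w : (forall k, 0 <= w k <= 1) -> good w.
Proof.
move=> w01; split=> [k|]; first by have /andP[] := w01 k.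
apply: is_cvg_series_le v_cvg => k; have /andP[w0 w1] := w01 k.
rewrite mulr_ge0//= ?exprn_ge0// -[leRHS]mul1r ler_wpM2r//.
by rewrite expr_le1.
Qed.

Let SD w1 w2 n : good w1 -> good w2 ->
  S (fun k => w1 k + w2 k) n = S w1 n + S w2 n.
Proof.
move=> /good_is_cvg[c1 _] /good_is_cvg[c2 _].
exact: lim_series_mulDl.
Qed.

Let defectD w1 w2 : good w1 -> good w2 ->
  defect (fun k => w1 k + w2 k) = defect w1 + defect w2.
Proof.
move=> g1 g2; have [_ c1 _] := good_cvg g1; have [_ c2 _] := good_cvg g2.
have [_ d1] := good_is_cvg g1; have [_ d2] := good_is_cvg g2.
rewrite /defect /D lim_series_mulDl//.
have -> : S (fun k => w1 k + w2 k) = S w1 + S w2.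
  by apply/funext => n; rewrite SD.
by rewrite lim_seriesD//; ring.
Qed.

(** With finitely many columns the exchange of sums is just [a_cvg] added up over [k < K]. This is
    why the defect depends only on tails. *)
Let defect_init (K : nat) : defect (fun k => (k < K)%:R) = 0.
Proof.
have sumK (x : R^nat) :
  \sum_(0 <= k < K) (k < K)%:R * x k = \sum_(0 <= k < K) x k.
  by apply: eq_big_nat => k /andP[_ ->]; rewrite mul1r.
have D0 (x : R^nat) k : (K <= k)%N -> (k < K)%:R * x k = 0.
  by move=> Kk; rewrite ltnNge Kk mul0r.
rewrite /defect /D (cvg_lim _ (series_eventually0 (D0 d)))// sumK.
have -> : S (fun k => (k < K)%:R) = fun n => \sum_(0 <= k < K) a n k.
  apply/funext => n; rewrite /S (cvg_lim _ (series_eventually0 (D0 (a n))))//.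
rewrite (@cvg_lim _ _ _ _ _ _ (\sum_(0 <= k < K) d k)) ?subrr//.
have -> : series (fun n => \sum_(0 <= k < K) a n k) =
          fun n => \sum_(0 <= k < K) series (a^~ k) n.
  by apply/funext => n; rewrite /series /= exchange_big.
by apply: cvg_big => [|k _]; [exact: add_continuous|exact: a_cvg].
Qed.

Let good_tail (K : nat) : good (fun k => (K <= k)%:R).
Proof. by apply: good_bounded => k; case: leqP; rewrite ?lexx ler01. Qed.

Let defect_tail (K : nat) : defect (fun k => (K <= k)%:R) = defect (fun=> 1).
Proof.
have -> : (fun=> 1) = (fun k => (k < K)%:R + (K <= k)%:R :> R).
  by apply/funext => k; case: leqP; rewrite ?add0r ?addr0.
rewrite defectD ?defect_init ?add0r//.
by apply: good_bounded => k; case: ltnP; rewrite ?lexx ler01.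
Qed.

(** Bounds the effect on the first [F] terms of raising the weight at column [k] by one. *)
Let b (F k : nat) := \sum_(0 <= m < F) `|a m k|.

Let good1 : good (fun=> 1). Proof. by apply: good_bounded => k; rewrite ler01 lexx. Qed.

Let b_ge0 F k : 0 <= b F k. Proof. exact: sumr_ge0. Qed.

Let b_cvg F : cvgn (series (b F)).
Proof.
have [ca _ _] := good_cvg good1.
elim: F => [|F IH].
  have -> : b 0 = fun=> 0 by apply/funext => k; rewrite /b big_nil.
  by apply/cvg_ex; exists (\sum_(0 <= k < 0) 0); apply: series_eventually0.
have -> : b F.+1 = b F + (fun k => `|a F k|).
  by apply/funext => k; rewrite /b big_nat_recr.
apply: is_cvg_seriesD => //; move: (ca F).
by under [X in series X]eq_fun do rewrite mul1r.
Qed.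

(* (current weight, last cut-off K_j, length of the partial sum, stage j) *)
Let state := (R^nat * nat * nat * nat)%type.

Let inv (s : state) := let: (w, K, F, j) := s in
  good w /\ `|series (S w) F - limn (series (S w))| <= 1.

(** The two tail bounds serve different ends. The first limits the growth of the sum of
    [w k ^+ 2 * v k], because [(w + 1) ^+ 2 - w ^+ 2 = 2 * w + 1], and keeps the limit weight good.
    The second keeps the partial sum of length [F], already close to its limit, almost unchanged by
    all later stages. *)
Let step (s s' : state) :=
  let: (w, K, F, j) := s in let: (w', K', F', j') := s' in
  [/\ j' = j.+1, (K < K')%N, (F <= F')%N &
   [/\ w' = (fun k => w k + (K' <= k)%:R),
       forall n, \sum_(K' <= k < n) (2 * w k + 1) * v k <= 2^-1 ^+ j &
       forall n, \sum_(K' <= k < n) b F k <= 2^-1 ^+ j]].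

Let partial_close w F : good w ->
  exists F', (F <= F')%N /\ `|series (S w) F' - limn (series (S w))| <= 1.
Proof.
move=> gw; have [_ cS _] := good_cvg gw.
have /cvgrPdist_le/(_ 1 ltr01)[F1 _ HF] :
  series (S w) @ \oo --> limn (series (S w)) by [].
exists (maxn F F1); split; first exact: leq_maxl.
by rewrite distrC; apply: HF; rewrite /= leq_maxr.
Qed.

Let next s : inv s -> exists s', inv s' /\ step s s'.
Proof.
case: s => [[[w K] F] j] [gw _]; have [w0 cw] := gw.
have p j' : 0 < 2^-1 ^+ j' :> R by rewrite exprn_gt0.
have c1 : cvgn (series (fun k => (2 * w k + 1) * v k)).
  pose t := (fun k => w k ^+ 2 * v k) + 2 *: v.
  apply: (@is_cvg_series_le _ _ t) => [k|]; last first.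
    by apply: is_cvg_seriesD => //; exact: is_cvg_seriesZ.
  have := v_ge0 k; have := w0 k => wk vk.
  rewrite mulr_ge0//=; last by rewrite addr_ge0// mulr_ge0.
  (* The gap between [w ^+ 2 + 2] and [2 * w + 1] is the square of [w - 1]. *)
  rewrite /t -subr_ge0 [leRHS](_ : _ = (w k - 1) ^+ 2 * v k).
    by rewrite mulr_ge0// sqr_ge0.
  rewrite [X in X - _](_ : _ = w k ^+ 2 * v k + 2 * v k)//; ring.
have n1 k : 0 <= (2 * w k + 1) * v k.
  by rewrite mulr_ge0// addr_ge0// mulr_ge0.
(* The cut-off [K1] meets the first tail bound; moving on to [K2] meets the second and keeps the
   first, whose terms are nonnegative. *)
have [K1 [KK1 H1]] := series_nneg_tail K n1 c1 (p j).
have [K2 [KK2 H2]] := series_nneg_tail K1 (b_ge0 F) (@b_cvg F) (p j).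
pose w' k := w k + (K2 <= k)%:R.
have gw' : good w' by apply: goodD => //; exact: good_tail.
have [F' [FF' HF']] := partial_close F gw'.
exists (w', K2, F', j.+1); split; first by split.
split => //; first exact: ltn_trans KK2.
split => // n; apply: le_trans (H1 n).
have [nK2|K2n] := leqP n K2; first by rewrite big_geq// sumr_ge0.
rewrite [leRHS](big_cat_nat (ltnW KK2) (ltnW K2n))/= lerDr.
by rewrite sumr_ge0.
Qed.

Let chain : exists f : nat -> state,
  [/\ forall i, inv (f i), forall i, step (f i) (f i.+1) &
      (f 0%N).1.1.1 = (fun=> 1) /\ (f 0%N).2 = 0%N].
Proof.
have [F [_ HF]] := partial_close 0 good1.
(* Dependent choice asks for a successor of every state; outside [inv] it is the arbitrary value
   [s]. *)
have st (s : state) : {s' | inv s -> inv s' /\ step s s'}.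
  apply: cid; have [/next[s' ?]|?] := pselect (inv s); last by exists s.
  by exists s'.
have [f [f0 fS]] := dependent_choice st ((fun=> 1), 0%N, F, 0%N).
have fi i : inv (f i).
  elim: i => [|i IH]; first by rewrite f0.
  by have [] := fS i IH.
exists f; split => // [i|]; first by have [] := fS i (fi i).
by rewrite f0.
Qed.

Let sum_tail (K n : nat) (x : R^nat) :
  \sum_(0 <= k < n) (K <= k)%:R * x k = \sum_(K <= k < n) x k.
Proof.
rewrite (big_nat_widenl K 0%N)// [RHS]big_mkcond/=.
by apply: eq_bigr => k _; case: leqP; rewrite (mul1r, mul0r).
Qed.

Let chain_seq : exists (w : nat -> R^nat) (K F : nat -> nat),
  [/\ forall i, good (w i) /\ `|series (S (w i)) (F i) - limn (series (S (w i)))| <= 1,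
      forall i, (K i < K i.+1)%N /\ (F i <= F i.+1)%N,
      w 0%N = (fun=> 1) /\ (forall i, w i.+1 = (fun k => w i k + (K i.+1 <= k)%:R)),
      forall i n, \sum_(K i.+1 <= k < n) (2 * w i k + 1) * v k <= 2^-1 ^+ i &
      forall i n, \sum_(K i.+1 <= k < n) b (F i) k <= 2^-1 ^+ i].
Proof.
have [f [fi fS [fw fj]]] := chain.
have fjE i : (f i).2 = i.
  elim: i => // i IH; have := fS i.
  by move: IH; case: (f i) => [[[? ?] ?] j]; case: (f i.+1) => [[[? ?] ?] ?] /= -> [].
have fE i : f i = ((f i).1.1.1, (f i).1.1.2, (f i).1.2, i).
  by have := fjE i; case: (f i) => [[[? ?] ?] ?] /= ->.
pose w i := (f i).1.1.1; pose K i := (f i).1.1.2; pose F i := (f i).1.2.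
have st i : step (w i, K i, F i, i) (w i.+1, K i.+1, F i.+1, i.+1).
  by have := fS i; rewrite (fE i) (fE i.+1).
have iv i : inv (w i, K i, F i, i) by have := fi i; rewrite (fE i).
exists w, K, F; split => [i|i|||].
- exact: iv.
- by have [_ ? ? _] := st i.
- by split => // i; have [_ _ _ []] := st i.
- by move=> i n; have [_ _ _ []] := st i.
- by move=> i n; have [_ _ _ []] := st i.
Qed.

(** The weights [w j] have defect [j.+1%:R * delta], yet their partial sums of length [F j] stay
    within a fixed distance of those of one good weight [W], which are bounded. Hence [delta]
    vanishes. *)
Let defect1 : defect (fun=> 1) = 0.
Proof.
have [w [K [F [iv kf [w_0 wS] tv tb]]]] := chain_seq.
set delta := defect (fun=> 1).
have Ki i : (i <= K i)%N.
  by elim: i => // i IH; have [+ _] := kf i; exact: leq_ltn_trans.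
have wle i k : w i k <= w i.+1 k by rewrite wS lerDl.
have wmono k i j : (i <= j)%N -> w i k <= w j k.
  by apply: (@nondecreasing_homo _ (w^~ k)).
have wstab k i : (k <= i)%N -> w i k = w k k.
  elim: i => [|i IH]; first by rewrite leqn0 => /eqP ->.
  rewrite leq_eqVlt => /orP[/eqP ->//|ki].
  by rewrite wS leqNgt (leq_trans ki (Ki _)) addr0 IH.
(* Column [k] is not changed after stage [k], since [k <= i] gives [k < K i.+1]. The diagonal is
   thus the pointwise limit of the weights. *)
pose W k := w k k.
have Wge i k : w i k <= W k.
  have [ki|ik] := leqP k i; first by rewrite wstab.
  by apply: wmono; exact: ltnW.
(* The term [2 - 2 * 2^-1 ^+ j] is the sum of the first [j] powers of 1/2, one for each stage. *)
have sq j n : \sum_(0 <= k < n) w j k ^+ 2 * v k <=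
    limn (series v) + (2 - 2 * 2^-1 ^+ j).
  elim: j => [|j IH].
    rewrite expr0 mulr1 subrr addr0 w_0.
    under eq_bigr do rewrite expr1n mul1r.
    exact: series_nneg_bounded.
  have -> : \sum_(0 <= k < n) w j.+1 k ^+ 2 * v k =
     \sum_(0 <= k < n) w j k ^+ 2 * v k +
     \sum_(0 <= k < n) (K j.+1 <= k)%:R * ((2 * w j k + 1) * v k).
    rewrite -big_split/=; apply: eq_bigr => k _; rewrite wS.
    by case: (K j.+1 <= k)%N => /=; ring.
  rewrite sum_tail; have := tv j n; rewrite exprS => ?; lra.
have gW : good W.
  split => [k|]; first by have [[+ _] _] := iv k; exact.
  apply: nondecreasing_is_cvgn.
    by apply: nondecreasing_series => k _ _; rewrite mulr_ge0// sqr_ge0.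
  exists (limn (series v) + 2) => _ [n _ <-].
  apply: le_trans (_ : limn (series v) + (2 - 2 * 2^-1 ^+ n) <= _); last first.
    by rewrite lerD2l gerBl// mulr_ge0// exprn_ge0.
  (* Below [n] the weights [W] and [w n] agree, so the uniform bound for [w n] passes to [W]. *)
  apply: le_trans (sq n n); rewrite /series /= le_eqVlt; apply/orP; left; apply/eqP.
  by apply: eq_big_nat => k /andP[_ kn]; rewrite wstab// ltnW.
have Fmono i j : (i <= j)%N -> (F i <= F j)%N.
  elim: j => [|j IH]; first by rewrite leqn0 => /eqP ->.
  rewrite leq_eqVlt => /orP[/eqP ->//|ij].
  by have [_] := kf j; apply: leq_trans; exact: IH.
have bmono i j k : (i <= j)%N -> b (F i) k <= b (F j) k.
  move=> ij; rewrite /b [leRHS](big_cat_nat (leq0n _) (Fmono _ _ ij))/= lerDl.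
  exact: sumr_ge0.
(* Stage [j + t] adds a tail on which [b (F (j + t))], and so the smaller [b (F j)], sums to at most
   [2^-1 ^+ t]; the right-hand side is again a geometric sum. *)
have rb j t n : \sum_(0 <= k < n) (w (j + t)%N k - w j k) * b (F j) k <=
    2 - 2 * 2^-1 ^+ t.
  elim: t => [|t IH].
    rewrite addn0 expr0 mulr1 subrr big1// => k _.
    by rewrite subrr mul0r.
  have -> : \sum_(0 <= k < n) (w (j + t.+1)%N k - w j k) * b (F j) k =
     \sum_(0 <= k < n) (w (j + t)%N k - w j k) * b (F j) k +
     \sum_(0 <= k < n) (K (j + t).+1 <= k)%:R * b (F j) k.
    by rewrite -big_split/=; apply: eq_bigr => k _; rewrite addnS wS; ring.
  rewrite sum_tail.
  have h1 : \sum_(K (j + t).+1 <= k < n) b (F j) k <= 2^-1 ^+ t.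
    apply: le_trans (_ : 2^-1 ^+ (j + t) <= _).
      apply: le_trans (tb (j + t)%N n); apply: ler_sum => k _.
      by apply: bmono; exact: leq_addr.
    by rewrite exprD ler_piMl ?exprn_ge0// exprn_ile1// invf_le1// ler1n.
  rewrite exprS; lra.
have rW j n : \sum_(0 <= k < n) (W k - w j k) * b (F j) k <= 2.
  apply: le_trans (_ : 2 - 2 * 2^-1 ^+ n <= _); last first.
    by rewrite gerBl// mulr_ge0// exprn_ge0.
  apply: le_trans (rb j n n); rewrite le_eqVlt; apply/orP; left; apply/eqP.
  apply: eq_big_nat => k /andP[_ kn]; rewrite (@wstab k (j + n)%N)//.
  exact: leq_trans (ltnW kn) (leq_addl _ _).
have [cWa cSW cWd] := good_cvg gW.
have cWa' := (good_is_cvg gW).1.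
have closeW j : `|series (S W) (F j) - series (S (w j)) (F j)| <= 2.
  have cwa' := (good_is_cvg (iv j).1).1.
  (* Only the finitely many rows below [F j] occur, so the difference is a limit of column-truncated
     sums, each of which [rW] bounds by 2. *)
  have c : (fun n => \sum_(0 <= m < F j)
       (series (fun k => W k * a m k) n - series (fun k => w j k * a m k) n))
     @ \oo --> series (S W) (F j) - series (S (w j)) (F j).
    rewrite /series/= -sumrB; apply: cvg_big => [|m _]; first exact: add_continuous.
    by apply: cvgB; [exact: cWa'|exact: cwa'].
  rewrite -(cvg_lim _ (cvg_norm c))//; apply: limr_le.
    by apply/cvg_ex; eexists; exact: (cvg_norm c).
  apply: nearW => n; apply: le_trans (rW j n).
  have -> : \sum_(0 <= m < F j)
       (series (fun k => W k * a m k) n - series (fun k => w j k * a m k) n) =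
     \sum_(0 <= k < n) (W k - w j k) * \sum_(0 <= m < F j) a m k.
    under [RHS]eq_bigr do rewrite mulr_sumr.
    rewrite exchange_big/=; apply: eq_bigr => m _.
    by rewrite /series/= -sumrB; apply: eq_bigr => k _; rewrite mulrBl.
  apply: le_trans (ler_norm_sum _ _ _) _; apply: ler_sum => k _.
  rewrite normrM ger0_norm ?subr_ge0//.
  by rewrite ler_wpM2l ?subr_ge0//; exact: ler_norm_sum.
(* The weight [w j] is the constant 1 plus [j] tails, and each of these [j.+1] summands has defect
   [delta]. *)
have dw j : defect (w j) = j.+1%:R * delta.
  elim: j => [|j IH]; first by rewrite w_0 mul1r.
  rewrite wS defectD ?IH ?defect_tail//; last by have [] := iv j.
  by rewrite -/delta -[j.+2]addn1 natrD mulrDl mul1r.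
pose E := limn (series (fun k => `|W k * d k|)).
have Dw j : `|D (w j)| <= E.
  have [_ _ cd] := good_cvg (iv j).1.
  apply: le_trans (lim_series_norm cd) _.
  apply: lim_series_le => // k; rewrite /= !normrM ler_wpM2r//.
  by have [[w0 _] _] := iv j; have [W0 _] := gW; rewrite !ger0_norm.
(* Here the assumed convergence at the weight [W] enters: the partial sums are bounded. *)
have [C HC] : exists C, forall n, `|series (S W) n| <= C.
  have [M [_ HM]] := cvg_seq_bounded cSW.
  by exists (M + 1) => n; apply: HM; rewrite // ltrDl.
(* In the constant, [C] bounds the partial sums at [W], 2 comes from [closeW], 1 from the invariant,
   and [E] bounds [D (w j)]. *)
have bd j : j.+1%:R * `|delta| <= C + 3 + E.
  rewrite -[X in X * _]ger0_norm// -normrM -dw /defect.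
  have := closeW j; have := Dw j; have := HC (F j); have [_] := iv j.
  rewrite !ler_norml => /andP[? ?] /andP[? ?] /andP[? ?] /andP[? ?].
  by apply/andP; split; lra.
apply/eqP; rewrite -normr_le0 leNgt; apply/negP => dpos.
have CE : 0 <= C + 3 + E by apply: le_trans (bd 0%N); rewrite mulr_ge0.
have := archi_boundP (divr_ge0 CE (ltW dpos)).
set m := Num.bound _; rewrite ltr_pdivrMr// => H.
have Hm : m%:R * `|delta| <= m.+1%:R * `|delta| by rewrite ler_wpM2r// ler_nat.
by have := lt_le_trans H (le_trans Hm (bd m)); rewrite ltxx.
Qed.

(** This is the vanishing of the defect at the constant weight 1. Absolute convergence of the double
    series is replaced by convergence for every good weight. *)
Lemma weighted_series_exchange :
  limn (series (fun n => limn (series (a n)))) = limn (series d).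
Proof.
have /eqP := defect1; rewrite /defect subr_eq0 => /eqP.
have mulf1 (x : R^nat) : (fun k => 1 * x k) = x.
  by apply/funext => k; rewrite mul1r.
rewrite /D mulf1 => <-; congr (limn (series _)).
by apply/funext => n; rewrite /S mulf1.
Qed.

End GlidingHump.

(** * Unordered sums over Z^2, reduced to series by an enumeration *)

Lemma Z2_enumeration : exists e : nat -> Z2, bijective e.
Proof.
have infZ : infinite_set [set: int].
  apply/infiniteP; apply: card_le_trans (card_image_le absz _).
  by apply: subset_card_le => n _; exists n%:Z.
have infZ2 : infinite_set [set: Z2] by rewrite -setXTT; exact: infinite_setX.
have /card_set_bijP[f] := eq_card_nat (countableP [set: Z2]) infZ2.
by rewrite setTT_bijective => -[e fK eK]; exists e; exists f.
Qed.

Section UnorderedSums.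
Variables (R : realType).
Implicit Types x y : Z2 -> R.

Definition rsummable x := summable [set: Z2] (fun n => (x n)%:E).

Lemma esum_series (e : nat -> Z2) y : bijective e -> (forall n, 0 <= y n) ->
  cvgn (series (y \o e)) ->
  (\esum_(n in [set: Z2]) (y n)%:E)%E = (limn (series (y \o e)))%:E.
Proof.
move=> eb y0 c.
have be : set_bij [set: nat] [set: Z2] e by rewrite setTT_bijective.
rewrite (reindex_esum _ _ _ _ be) -nneseries_esumT => [|n]; last by rewrite lee_fin.
rewrite -EFin_lim//; congr (lim (_ @ \oo)%classic).
by apply/funext => n; rewrite /series/= sumEFin.
Qed.

Lemma rsummableE (e : nat -> Z2) x : bijective e ->
  rsummable x <-> cvgn (series (fun k => `|x (e k)|)).
Proof.
move=> eb.
have be : set_bij [set: nat] [set: Z2] e by rewrite setTT_bijective.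
rewrite /rsummable /summable; split => [|c]; last first.
  by rewrite (@esum_series e (fun n => `|x n|))// ltry.
rewrite (reindex_esum _ _ _ _ be) => s.
apply: (@nnseries_is_cvg _ (fun k => `|x (e k)|)) => //.
by rewrite nneseries_esumT// => n; rewrite lee_fin.
Qed.

(** The positive and negative parts are dominated by the absolute value, so each converges along
    [e], and their difference is the series of [x]. *)
Lemma cvg_rsum (e : nat -> Z2) x : bijective e -> rsummable x ->
  series (x \o e) @ \oo --> rsum x.
Proof.
move=> eb /(rsummableE x eb) sx.
have pos y : (forall n, 0 <= y n <= `|x n|) -> series (y \o e) @ \oo -->
    fine (\esum_(n in [set: Z2]) (y n)%:E)%E.
  move=> yx; have cy : cvgn (series (y \o e)).
    by apply: is_cvg_series_le sx => k; exact: yx.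
  by rewrite (esum_series eb)// => n; have /andP[] := yx n.
rewrite /rsum; have -> : series (x \o e) = (fun n =>
    series ((fun n => Num.max (x n) 0) \o e) n -
    series ((fun n => Num.max (- x n) 0) \o e) n).
  apply/funext => n; rewrite /series/= -sumrB; apply: eq_bigr => k _.
  by case: (lerP 0 (x (e k))) => ?; case: (lerP 0 (- x (e k))) => ?; lra.
apply: cvgB; apply: pos => n; rewrite le_max lexx orbT/=.
  by rewrite ge_max ler_norm normr_ge0.
by rewrite ge_max -normrN ler_norm normr_ge0.
Qed.

Lemma rsum_unique (e : nat -> Z2) x l : bijective e -> rsummable x ->
  series (x \o e) @ \oo --> l -> rsum x = l.
Proof.
move=> eb sx xl; rewrite -(cvg_lim (@Rhausdorff _) (cvg_rsum eb sx)).
exact: cvg_lim.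
Qed.

Lemma rsummable_le x y :
  (forall n, `|x n| <= y n) -> rsummable y -> rsummable x.
Proof.
have [e eb] := Z2_enumeration => xy /(rsummableE _ eb) sy; apply/(rsummableE _ eb).
apply: is_cvg_series_le sy => k; rewrite normr_ge0/=.
by apply: le_trans (xy _) _; exact: ler_norm.
Qed.

Lemma rsummableD x y :
  rsummable x -> rsummable y -> rsummable (fun n => x n + y n).
Proof. exact: summableD. Qed.

Lemma rsummableZ (c : R) x : rsummable x -> rsummable (fun n => c * x n).
Proof.
have [e eb] := Z2_enumeration => /(rsummableE _ eb) sx; apply/(rsummableE _ eb).
have -> : (fun k => `|c * x (e k)|) = `|c| *: (fun k => `|x (e k)|).
  by apply/funext => k; rewrite normrM.
exact: is_cvg_seriesZ.
Qed.

Lemma rsumD x y : rsummable x -> rsummable y ->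
  rsum (fun n => x n + y n) = rsum x + rsum y.
Proof.
have [e eb] := Z2_enumeration => sx sy.
apply: (rsum_unique eb (rsummableD sx sy)).
have -> : series ((fun n => x n + y n) \o e) = series (x \o e) + series (y \o e).
  by rewrite -seriesD.
by apply: cvgD; exact: cvg_rsum.
Qed.

Lemma rsumZ (c : R) x : rsummable x -> rsum (fun n => c * x n) = c * rsum x.
Proof.
have [e eb] := Z2_enumeration => sx.
apply: (rsum_unique eb (rsummableZ c sx)).
have -> : series ((fun n => c * x n) \o e) = fun n => c * series (x \o e) n.
  by apply/funext => n; rewrite /series/= mulr_sumr.
by apply: cvgMr; exact: cvg_rsum.
Qed.

Lemma rsummable0 : rsummable (fun=> 0).
Proof.
by rewrite /rsummable /summable esum1 ?ltry// => n _; rewrite abse0.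
Qed.

Lemma rsum0 : rsum (fun=> 0 : R) = 0.
Proof.
have -> : (fun=> 0) = (fun n : Z2 => 0 * 0) :> (Z2 -> R).
  by apply/funext => n; rewrite mul0r.
by rewrite rsumZ ?mul0r//; exact: rsummable0.
Qed.

Lemma rsummable_sum (I : Type) (r : seq I) (x : I -> Z2 -> R) :
  (forall i, rsummable (x i)) -> rsummable (fun n => \sum_(i <- r) x i n).
Proof.
move=> sx; elim: r => [|i r IH].
  by under eq_fun do rewrite big_nil; exact: rsummable0.
by under eq_fun do rewrite big_cons; exact: rsummableD.
Qed.

Lemma rsum_sum (I : Type) (r : seq I) (x : I -> Z2 -> R) :
  (forall i, rsummable (x i)) ->
  rsum (fun n => \sum_(i <- r) x i n) = \sum_(i <- r) rsum (x i).
Proof.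
move=> sx; elim: r => [|i r IH].
  by under eq_fun do rewrite big_nil; rewrite big_nil rsum0.
under eq_fun do rewrite big_cons.
by rewrite rsumD ?IH ?big_cons//; exact: rsummable_sum.
Qed.

Lemma rsum_supp1 (k : Z2) x : (forall n, n != k -> x n = 0) ->
  rsummable x /\ rsum x = x k.
Proof.
have [e eb] := Z2_enumeration; have [e' eK e'K] := eb => xk.
have x0 j : (e' k < j)%N -> x (e j) = 0.
  move=> kj; apply: xk; apply/eqP => ejk.
  by move: kj; rewrite -ejk eK ltnn.
(* Taking [f] to be the absolute value gives summability; the identity gives the value of the
   sum. *)
have sum1 (f : R -> R) : f 0 = 0 ->
    series (fun j => f (x (e j))) @ \oo --> f (x k).
  move=> f0; have : forall j, (e' k < j)%N -> f (x (e j)) = 0.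
    by move=> j /x0 ->.
  move/series_eventually0; rewrite big_nat_recr//= e'K big_nat_cond big1 ?add0r//.
  move=> j /andP[/andP[_ jk] _]; rewrite xk//.
  by apply/eqP => ejk; move: jk; rewrite -ejk eK ltnn.
have sx : rsummable x.
  by apply/(rsummableE _ eb)/cvg_ex; exists `|x k|; apply: sum1; rewrite normr0.
split=> //; apply: (rsum_unique eb sx).
exact: (sum1 id).
Qed.

Lemma reindex_rsum (s : Z2 -> Z2) x : bijective s -> rsum (x \o s) = rsum x.
Proof.
rewrite -setTT_bijective => bs.
by rewrite /rsum; congr (fine _ - fine _); rewrite [RHS](reindex_esum _ _ _ _ bs).
Qed.

(** Both index sets are enumerated by the same [e]; a weight on the naturals becomes one on Z^2
    through the inverse [e']. *)
Lemma weighted_rsum_exchange (a : Z2 -> Z2 -> R) (d v : Z2 -> R) :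
  (forall k, 0 <= v k) -> rsummable v ->
  (forall w : Z2 -> R, (forall k, 0 <= w k) ->
     rsummable (fun k => w k ^+ 2 * v k) ->
     [/\ forall n, rsummable (fun k => w k * a n k),
         rsummable (fun n => rsum (fun k => w k * a n k)) &
         rsummable (fun k => w k * d k)]) ->
  (forall k, rsummable (a^~ k) /\ rsum (a^~ k) = d k) ->
  rsum (fun n => rsum (a n)) = rsum d.
Proof.
have [e eb] := Z2_enumeration; have [e' eK e'K] := eb => v0 sv good ad.
have rsumE x : rsummable x -> rsum x = limn (series (x \o e)).
  by move=> sx; apply/esym/cvg_lim => //; exact: cvg_rsum.
have H (w : nat -> R) : (forall k, 0 <= w k) ->
    cvgn (series (fun k => w k ^+ 2 * v (e k))) ->
    [/\ forall n, rsummable (fun k => w (e' k) * a n k),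
        rsummable (fun n => rsum (fun k => w (e' k) * a n k)) &
        rsummable (fun k => w (e' k) * d k)].
  move=> w0 cw; apply: (good (w \o e')) => [k|]; first exact: w0.
  apply/(rsummableE _ eb); apply: eq_is_cvg_series cw => k /=.
  by rewrite eK ger0_norm// mulr_ge0// sqr_ge0.
have one x : (fun k => (fun=> 1) (e' k) * x k) = x :> (Z2 -> R).
  by apply/funext => k; rewrite mul1r.
have c1 : cvgn (series (fun k => (fun=> 1) k ^+ 2 * v (e k))).
  move/(rsummableE _ eb): sv; apply: eq_is_cvg_series => k.
  by rewrite expr1n mul1r ger0_norm.
have [] := H (fun=> 1) (fun=> ler01) c1.
rewrite one => sa ssa sd.
have sa' n : rsummable (a n) by have := sa n; rewrite one.
have {}ssa : rsummable (fun n => rsum (a n)).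
  by move: ssa; under eq_fun do rewrite one.
rewrite (rsumE _ ssa) (rsumE _ sd).
pose a' n k := a (e n) (e k).
have -> : (fun n => rsum (a n)) \o e = fun n => limn (series (a' n)).
  by apply/funext => n /=; rewrite rsumE.
apply: (@weighted_series_exchange _ a' (d \o e) (v \o e)) => [k||w [w0 cw]|k].
- exact: v0.
- move/(rsummableE _ eb): sv; apply: eq_is_cvg_series => k /=.
  by rewrite ger0_norm.
- have [h1 h2 h3] := H w w0 cw; split.
  + move=> n; have /(rsummableE _ eb) := h1 (e n).
    by under eq_fun do rewrite eK.
  + have /(rsummableE _ eb)/normed_cvg := h2.
    apply: eq_is_cvg_series => n; rewrite rsumE//.
    by congr (limn (series _)); apply/funext => k; rewrite /= eK.
  + have /(rsummableE _ eb) := h3.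
    by under eq_fun do rewrite eK.
- by have [sk] := ad (e k); rewrite /= => <-; exact: (cvg_rsum eb sk).
Qed.

End UnorderedSums.

End RealSeries.

(** * Quaternion algebra, real functionals and l2 *)

Section Quaternions.
Local Set Implicit Arguments.
Local Unset Strict Implicit.
Local Open Scope classical_set_scope.
Variable R : realType.
Local Notation H := (quat R).
Implicit Types (x y q : H) (l : H -> R) (f phi : Z2 -> H).

Lemma qaddE x y : x + y = Quat (qre x + qre y) (qi x + qi y) (qj x + qj y) (qk x + qk y).
Proof. by []. Qed.

Lemma qmulE x y : x * y =
  Quat (qre x * qre y - qi x * qi y - qj x * qj y - qk x * qk y)
       (qre x * qi y + qi x * qre y + qj x * qk y - qk x * qj y)
       (qre x * qj y - qi x * qk y + qj x * qre y + qk x * qi y)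
       (qre x * qk y + qi x * qj y - qj x * qi y + qk x * qre y).
Proof. by []. Qed.

Lemma qreal_comm (a : R) x : x * qreal a = qreal a * x.
Proof. by case: x => *; rewrite !qmulE /=; congr Quat; ring. Qed.

Lemma qrealM (a b : R) : qreal (a * b) = qreal a * qreal b.
Proof. by rewrite qmulE /=; congr Quat; ring. Qed.

Lemma qrealD (a b : R) : qreal (a + b) = qreal a + qreal b.
Proof. by rewrite qaddE /=; congr Quat; ring. Qed.

Lemma qreal0 : qreal (0 : R) = 0. Proof. by []. Qed.

Lemma qreal1 : qreal (1 : R) = 1. Proof. by []. Qed.

Lemma qreal_sum (I : Type) (r : seq I) (P : pred I) (F : I -> R) :
  qreal (\sum_(i <- r | P i) F i) = \sum_(i <- r | P i) qreal (F i).
Proof. exact: (big_morph (@qreal R) qrealD qreal0). Qed.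

Lemma qconjM x y : qconj (x * y) = qconj y * qconj x.
Proof. by case: x y => ? ? ? ? [? ? ? ?]; rewrite !qmulE /qconj /=; congr Quat; ring. Qed.

Lemma qconj0 : qconj (0 : H) = 0.
Proof. by rewrite /qconj /=; congr Quat; exact: oppr0. Qed.

Lemma qabs_sq x : qabs x ^+ 2 = qre x ^+ 2 + qi x ^+ 2 + qj x ^+ 2 + qk x ^+ 2.
Proof. by rewrite sqr_sqrtr// !addr_ge0// sqr_ge0. Qed.

Lemma qabs_ge0 x : 0 <= qabs x. Proof. exact: sqrtr_ge0. Qed.

Lemma eq_qabs_sq x (a : R) : 0 <= a -> qabs x ^+ 2 = a ^+ 2 -> qabs x = a.
Proof.
by move=> a0 /eqP; rewrite eqrXn2 ?qabs_ge0// => /eqP.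
Qed.

Lemma qabsM x y : qabs (x * y) = qabs x * qabs y.
Proof.
apply: eq_qabs_sq; first by rewrite mulr_ge0 ?qabs_ge0.
by rewrite exprMn !qabs_sq; case: x y => ? ? ? ? [? ? ? ?]; rewrite !qmulE /=; ring.
Qed.

Lemma qabs_conj x : qabs (qconj x) = qabs x.
Proof. by rewrite /qabs /qconj /= !sqrrN. Qed.

Lemma qabs_real (a : R) : qabs (qreal a) = `|a|.
Proof.
by apply: eq_qabs_sq => //; rewrite qabs_sq /= real_normK ?num_real//; ring.
Qed.

Lemma qabs_expi (t : R) : qabs (expi t) = 1.
Proof.
by apply: eq_qabs_sq => //; rewrite qabs_sq /= cos2Dsin2; ring.
Qed.

Lemma qabs_expj (t : R) : qabs (expj t) = 1.
Proof.
by apply: eq_qabs_sq => //; rewrite qabs_sq /= -[1 ^+ 2]/(1 * 1) -{1}(cos2Dsin2 t); ring.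
Qed.

(** Real-linear functionals reduce quaternionic identities and sums to real ones: they separate
    points ([eq_rlin]) and absorb left and right multiplications by fixed quaternions. *)
Definition rlin l :=
  (forall x y, l (x + y) = l x + l y) /\ (forall a x, l (qreal a * x) = a * l x).

Lemma rlin0 l : rlin l -> l 0 = 0.
Proof. by move=> [_ lZ]; rewrite -(mul0r (0 : H)) -qreal0 lZ mul0r. Qed.

Lemma rlin_sum l (I : Type) (r : seq I) (P : pred I) (F : I -> H) : rlin l ->
  l (\sum_(i <- r | P i) F i) = \sum_(i <- r | P i) l (F i).
Proof. by move=> ll; apply: (big_morph l ll.1); exact: rlin0. Qed.

Lemma rlin_mull l q : rlin l -> rlin (fun x => l (q * x)).
Proof.
move=> [lD lZ]; split => [x y|a x]; first by rewrite mulrDr lD.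
by rewrite mulrA qreal_comm -mulrA lZ.
Qed.

Lemma rlin_mulr l q : rlin l -> rlin (fun x => l (x * q)).
Proof.
move=> [lD lZ]; split => [x y|a x]; first by rewrite mulrDl lD.
by rewrite -mulrA lZ.
Qed.

Lemma rlin_conj l : rlin l -> rlin (fun x => l (qconj x)).
Proof.
move=> [lD lZ]; split => [[? ? ? ?] [? ? ? ?]|a x].
  by rewrite -lD !qaddE /qconj /=; congr (l (Quat _ _ _ _)); ring.
rewrite qconjM -lZ -qreal_comm; congr (l (_ * _)).
by rewrite /qconj /= oppr0.
Qed.

Lemma rlin_qre : rlin (@qre R).
Proof. by split=> [[? ? ? ?] [? ? ? ?]|a [? ? ? ?]]//; rewrite qmulE /=; ring. Qed.

Lemma rlin_qi : rlin (@qi R).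
Proof. by split=> [[? ? ? ?] [? ? ? ?]|a [? ? ? ?]]//; rewrite qmulE /=; ring. Qed.

Lemma rlin_qj : rlin (@qj R).
Proof. by split=> [[? ? ? ?] [? ? ? ?]|a [? ? ? ?]]//; rewrite qmulE /=; ring. Qed.

Lemma rlin_qk : rlin (@qk R).
Proof. by split=> [[? ? ? ?] [? ? ? ?]|a [? ? ? ?]]//; rewrite qmulE /=; ring. Qed.

Lemma eq_rlin x y : (forall l, rlin l -> l x = l y) -> x = y.
Proof.
move=> xy; have := (xy _ rlin_qre, xy _ rlin_qi, xy _ rlin_qj, xy _ rlin_qk).
by case: x y {xy} => ? ? ? ? [? ? ? ?] /= [[[-> ->] ->] ->].
Qed.

Lemma rlinE l x : rlin l ->
  l x = l 1 * qre x + l (Quat 0 1 0 0) * qi x + l (Quat 0 0 1 0) * qj x +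
        l (Quat 0 0 0 1) * qk x.
Proof.
move=> [lD lZ]; rewrite ![l _ * _]mulrC -!lZ -!lD; congr l.
by case: x => ? ? ? ?; rewrite !qmulE !qaddE /=; congr Quat; ring.
Qed.

Lemma rlin_bound l : rlin l -> exists2 C, 0 <= C & forall x, `|l x| <= C * qabs x.
Proof.
move=> ll; pose c := `|l 1| + `|l (Quat 0 1 0 0)| + `|l (Quat 0 0 1 0)| +
  `|l (Quat 0 0 0 1)|.
exists c => [|x]; first by rewrite /c !addr_ge0.
have h (a : R) : a ^+ 2 <= qabs x ^+ 2 -> `|a| <= qabs x.
  by move=> ha; rewrite -ler_sqr ?nnegrE ?qabs_ge0// real_normK ?num_real.
rewrite (rlinE _ ll) /c !mulrDl.
have p1 := sqr_ge0 (qre x); have p2 := sqr_ge0 (qi x).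
have p3 := sqr_ge0 (qj x); have p4 := sqr_ge0 (qk x).
do ![apply: le_trans (ler_normD _ _) _; apply: lerD];
  rewrite normrM ler_wpM2l//; apply: h; rewrite qabs_sq; lra.
Qed.

Lemma rsummable_rlin l (x : Z2 -> H) : rlin l -> qsummable x -> rsummable (l \o x).
Proof.
move=> /rlin_bound[C C0 lC] sx.
have sx' : rsummable (fun n => qabs (x n)) by [].
apply: (rsummable_le (y := fun n => C * qabs (x n))) => [n|]; first exact: lC.
exact: rsummableZ.
Qed.

(** Every functional is a real combination of the four components. Summability is stated through
    functionals because [rsummable_inner] and the point mass computations supply it in that form. *)
Lemma rlin_qsum l (x : Z2 -> H) : rlin l ->
  (forall l', rlin l' -> rsummable (l' \o x)) ->
  l (qsum x) = rsum (l \o x).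
Proof.
move=> ll sx; rewrite (rlinE _ ll) /=.
have s1 := rsummableZ (l 1) (sx _ rlin_qre).
have s2 := rsummableZ (l (Quat 0 1 0 0)) (sx _ rlin_qi).
have s3 := rsummableZ (l (Quat 0 0 1 0)) (sx _ rlin_qj).
have s4 := rsummableZ (l (Quat 0 0 0 1)) (sx _ rlin_qk).
have -> : l \o x = fun n => l 1 * qre (x n) + l (Quat 0 1 0 0) * qi (x n) +
    l (Quat 0 0 1 0) * qj (x n) + l (Quat 0 0 0 1) * qk (x n).
  by apply/funext => n; exact: rlinE.
have s12 := rsummableD s1 s2; have s123 := rsummableD s12 s3.
rewrite (rsumD s123 s4) (rsumD s12 s3) (rsumD s1 s2).
by rewrite !rsumZ//; [exact: (sx _ rlin_qk)|exact: (sx _ rlin_qj)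
  |exact: (sx _ rlin_qi)|exact: (sx _ rlin_qre)].
Qed.

Lemma qsum_real (a : Z2 -> R) : qsum (fun n => qreal (a n)) = qreal (rsum a).
Proof. by rewrite /qsum /= rsum0. Qed.

(** The product of the moduli of [f k] and [phi k] is at most the sum of their squares. *)
Lemma rsummable_inner l f phi : rlin l -> l2 f -> l2 phi ->
  rsummable (fun k => l (qconj (f k) * phi k)).
Proof.
move=> /rlin_bound[C C0 lC] sf sphi.
have sf' : rsummable (fun k => qabs (f k) ^+ 2) by [].
have sphi' : rsummable (fun k => qabs (phi k) ^+ 2) by [].
apply: rsummable_le (rsummableZ C (rsummableD sf' sphi')) => k.
apply: le_trans (lC _) _; rewrite ler_wpM2l// qabsM qabs_conj.
have := qabs_ge0 (f k); have := qabs_ge0 (phi k).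
move: (qabs (f k)) (qabs (phi k)) => a b; nra.
Qed.

Lemma rlin_inner l f phi : rlin l -> l2 f -> l2 phi ->
  l (inner f phi) = rsum (fun k => l (qconj (f k) * phi k)).
Proof.
move=> ll sf sphi; rewrite /inner rlin_qsum// => l' ll'.
exact: rsummable_inner.
Qed.

Definition delta (k : Z2) q : Z2 -> H := fun k' => if k' == k then q else 0.

Lemma l2_delta k q : l2 (delta k q).
Proof.
have [] // := @rsum_supp1 _ k (fun k' => qabs (delta k q k') ^+ 2).
move=> k' k'k; rewrite /delta (negbTE k'k) -qreal0 qabs_real normr0.
by rewrite expr0n.
Qed.

Lemma inner_deltal k q phi : inner (delta k q) phi = qconj q * phi k.
Proof.
have h l : rlin l -> rsummable (l \o (fun k' => qconj (delta k q k') * phi k')) /\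
   rsum (l \o (fun k' => qconj (delta k q k') * phi k')) = l (qconj q * phi k).
  move=> ll.
  have [k' k'k|s ->] := @rsum_supp1 _ k (l \o (fun k' => qconj (delta k q k') * phi k')).
    by rewrite /= /delta (negbTE k'k) qconj0 mul0r rlin0.
  by split => //; rewrite /= /delta eqxx.
apply: eq_rlin => l ll; rewrite /inner rlin_qsum//; first exact: (h l ll).2.
by move=> l' /h[].
Qed.

Lemma inner_deltar k q f : inner f (delta k q) = qconj (f k) * q.
Proof.
have h l : rlin l -> rsummable (l \o (fun k' => qconj (f k') * delta k q k')) /\
   rsum (l \o (fun k' => qconj (f k') * delta k q k')) = l (qconj (f k) * q).
  move=> ll.
  have [k' k'k|s ->] := @rsum_supp1 _ k (l \o (fun k' => qconj (f k') * delta k q k')).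
    by rewrite /= /delta (negbTE k'k) mulr0 rlin0.
  by split => //; rewrite /= /delta eqxx.
apply: eq_rlin => l ll; rewrite /inner rlin_qsum//; first exact: (h l ll).2.
by move=> l' /h[].
Qed.

(** Stands in for continuity: the functional is determined by its values on point masses, through an
    absolutely convergent sum. *)
Definition l2_functional (L : (Z2 -> H) -> R) (lam : Z2 -> H -> R) :=
  (forall k, rlin (lam k)) /\
  forall phi, l2 phi ->
    rsummable (fun k => lam k (phi k)) /\ L phi = rsum (fun k => lam k (phi k)).

Lemma l2_functional_innerr l f : rlin l -> l2 f ->
  l2_functional (fun phi => l (inner f phi)) (fun k x => l (qconj (f k) * x)).
Proof.
move=> ll sf; split => [k|phi sphi]; first exact: rlin_mull.
by split; [exact: rsummable_inner|exact: rlin_inner].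
Qed.

Lemma l2_functional_innerl l phi : rlin l -> l2 phi ->
  l2_functional (fun f => l (inner f phi)) (fun k x => l (qconj x * phi k)).
Proof.
move=> ll sphi; split => [k|f sf]; last first.
  by split; [exact: rsummable_inner|exact: rlin_inner].
exact: (rlin_conj (rlin_mulr (phi k) ll)).
Qed.

Lemma l2_functional_sum (I : Type) (r : seq I) (L : I -> (Z2 -> H) -> R)
    (lam : I -> Z2 -> H -> R) :
  (forall i, l2_functional (L i) (lam i)) ->
  l2_functional (fun phi => \sum_(i <- r) L i phi)
                (fun k x => \sum_(i <- r) lam i k x).
Proof.
move=> Ll; split => [k|phi sphi].
  split => [x y|a x].
    by rewrite -big_split/=; apply: eq_bigr => i _; rewrite ((Ll i).1 k).1.
  by rewrite mulr_sumr; apply: eq_bigr => i _; rewrite ((Ll i).1 k).2.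
have s i : rsummable (fun k => lam i k (phi k)) by have [] := (Ll i).2 _ sphi.
split; first exact: rsummable_sum.
by rewrite rsum_sum//; apply: eq_bigr => i _; have [] := (Ll i).2 _ sphi.
Qed.

Lemma l2_functional_delta L lam k q : l2_functional L lam -> L (delta k q) = lam k q.
Proof.
move=> [ll /(_ _ (l2_delta k q))[_ ->]].
have [|_ ->] := @rsum_supp1 _ k (fun k' => lam k' (delta k q k')).
  by move=> k' k'k; rewrite /delta (negbTE k'k) rlin0.
by rewrite /delta eqxx.
Qed.

(** Extends an identity from point masses to l2 with no continuity of the sum over [n]. The gliding
    hump applies to [a n k = lam n k (phi k)], since summability holds at every weighted sequence
    [w phi] that remains in l2. *)
Lemma l2_functional_exchange (Q : Z2 -> (Z2 -> H) -> R) (lam : Z2 -> Z2 -> H -> R)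
    (L : (Z2 -> H) -> R) (mu : Z2 -> H -> R) :
  (forall n, l2_functional (Q n) (lam n)) -> l2_functional L mu ->
  (forall phi, l2 phi -> rsummable (Q^~ phi)) ->
  (forall k q, rsum (Q^~ (delta k q)) = L (delta k q)) ->
  forall phi, l2 phi -> rsum (Q^~ phi) = L phi.
Proof.
move=> Qf Lf sQ QL phi sphi.
have [_ ->] := Lf.2 _ sphi.
have -> : Q^~ phi = fun n => rsum (fun k => lam n k (phi k)).
  by apply/funext => n; have [_ ->] := (Qf n).2 _ sphi.
apply: (weighted_rsum_exchange (v := fun k => qabs (phi k) ^+ 2)) => [k||w w0 sw|k].
- exact: sqr_ge0.
- exact: sphi.
- pose wphi k := qreal (w k) * phi k.
  have swphi : l2 wphi.
    rewrite /l2; suff -> : (fun k => (qabs (wphi k) ^+ 2)%:E) =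
        (fun k => (w k ^+ 2 * qabs (phi k) ^+ 2)%:E) by [].
    apply/funext => k.
    by rewrite qabsM exprMn qabs_real real_normK ?num_real.
  (* Real weights come out of a real-linear functional. *)
  have e (nu : Z2 -> H -> R) : (forall k, rlin (nu k)) ->
      (fun k => nu k (wphi k)) = (fun k => w k * nu k (phi k)).
    by move=> nul; apply/funext => k; rewrite /wphi (nul k).2.
  have h n := (Qf n).2 _ swphi.
  have [+ _] := Lf.2 _ swphi; rewrite e; last exact: Lf.1.
  have := sQ _ swphi.
  rewrite (_ : Q^~ wphi = fun n => rsum (fun k => w k * lam n k (phi k))).
    move=> ? ?; split => // n.
    by have [+ _] := h n; rewrite e; last exact: (Qf n).1.
  by apply/funext => n; have [_ ->] := h n; rewrite e; last exact: (Qf n).1.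
(* The column sum over [n] at [k] is the hypothesis at the point mass of value [phi k]. *)
- have := QL k (phi k); rewrite (l2_functional_delta _ _ Lf) => <-.
  have e : Q^~ (delta k (phi k)) = fun n => lam n k (phi k).
    by apply/funext => n; rewrite (l2_functional_delta _ _ (Qf n)).
  by rewrite e; split => //; rewrite -e; apply: sQ; exact: l2_delta.
Qed.

End Quaternions.

(** * Orthogonality of the characters in the two imaginary units *)

Section Characters.
Local Set Implicit Arguments.
Local Unset Strict Implicit.
Variable R : realType.
Local Notation H := (quat R).

Lemma qabs_eq0 (x : H) : qabs x = 0 -> x = 0.
Proof.
move=> x0; have := qabs_sq x; rewrite x0 expr0n /=.
case: x {x0} => a b c d /= /eqP.
have ? := sqr_ge0 a; have ? := sqr_ge0 b; have ? := sqr_ge0 c; have ? := sqr_ge0 d.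
rewrite eq_sym !paddr_eq0 ?addr_ge0// !sqrf_eq0.
by move=> /andP[/andP[/andP[/eqP-> /eqP->] /eqP->] /eqP->].
Qed.

Lemma expiD (s t : R) : expi (s + t) = expi s * expi t.
Proof. by rewrite qmulE /expi /= cosD sinD; congr Quat; ring. Qed.

Lemma expjD (s t : R) : expj (s + t) = expj s * expj t.
Proof. by rewrite qmulE /expj /= cosD sinD; congr Quat; ring. Qed.

Lemma qconj_expi (t : R) : qconj (expi t) = expi (- t).
Proof. by rewrite /qconj /expi /= cosN sinN oppr0. Qed.

Lemma qconj_expj (t : R) : qconj (expj t) = expj (- t).
Proof. by rewrite /qconj /expj /= cosN sinN oppr0. Qed.

Lemma expj0 : expj (0 : R) = 1.
Proof. by rewrite /expj cos0 sin0. Qed.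

Lemma expj_mulrn (t : R) n : expj (t *+ n) = expj t ^+ n.
Proof. by elim: n => [|n IH]; rewrite ?mulr0n ?expj0// mulrS expjD IH exprS. Qed.

Lemma expj_2pi_int (d : int) : expj (2 * pi * d%:~R : R) = 1.
Proof.
have pos (n : nat) : expj (2 * pi * n%:R : R) = 1.
  rewrite mulr_natr expj_mulrn.
  have -> : expj (2 * pi : R) = 1 by rewrite mulr_natl /expj cos2pi sin2pi.
  by rewrite expr1n.
case: d => n; first exact: pos.
rewrite NegzE mulrNz mulrN -[LHS]mul1r -[X in X * _](pos n.+1) -expjD.
by rewrite subrr expj0.
Qed.

Lemma expj_neq1 (M : nat) (d : int) : (0 < M)%N -> ~~ (M %| d)%Z ->
  expj (2 * pi * (d%:~R / M%:R) : R) != 1.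
Proof.
move=> M0 Md; set r := (d %% M)%Z.
have M0' : M%:R != 0 :> R by rewrite pnatr_eq0 -lt0n.
have r0 : 0 < r.
  by rewrite lt_def modz_ge0 ?andbT; [apply: contra Md => /eqP/dvdz_mod0P|rewrite -lt0n].
have rM : r < M by apply: ltz_pmod.
have -> : expj (2 * pi * (d%:~R / M%:R) : R) = expj (2 * pi * (r%:~R / M%:R)).
  rewrite {1}(divz_eq d M) -/r intrD intrM -pmulrn [(_ + r%:~R) / _]mulrDl mulfK// mulrDr expjD.
  by rewrite expj_2pi_int mul1r.
(* With half the angle, [x] lies strictly between 0 and pi, so its sine is positive and the cosine
   of [x *+ 2] is less than 1. *)
set x : R := pi * (r%:~R / M%:R).
have -> : 2 * pi * (r%:~R / M%:R) = x *+ 2 :> R by rewrite /x; ring.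
have sx : 0 < sin x.
  have Mp : 0 < M%:R :> R by rewrite ltr0n.
  apply: sin_gt0_pi; rewrite /x.
  rewrite mulr_gt0 ?pi_gt0 ?divr_gt0 ?ltr0z//=.
  by rewrite gtr_pMr ?pi_gt0// ltr_pdivrMr// mul1r -[M%:R]/(M%:~R) ltr_int.
apply/eqP => -[/eqP]; rewrite cos_mulr2n cos2sin2 => /eqP c.
have : 0 < sin x ^+ 2 by rewrite exprn_gt0.
by lra.
Qed.

(* sum over the M-th roots of unity of their d-th powers *)
Definition comb (M : nat) (d : int) : R := if (M %| d)%Z then M%:R else 0.

(** A geometric sum of powers of [z], where [z ^+ M = 1], and [z = 1] exactly when [M] divides
    [d]. *)
Lemma sum_expj (M : nat) (d : int) : (0 < M)%N ->
  \sum_(m < M) expj (2 * pi * ((m : nat)%:R / M%:R) * d%:~R) = qreal (comb M d).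
Proof.
move=> M0; have M0' : M%:R != 0 :> R by rewrite pnatr_eq0 -lt0n.
pose z := expj (2 * pi * (d%:~R / M%:R) : R).
have -> : \sum_(m < M) expj (2 * pi * ((m : nat)%:R / M%:R) * d%:~R) =
    \sum_(m < M) z ^+ m.
  apply: eq_bigr => m _; rewrite -expj_mulrn; congr expj.
  by rewrite -mulr_natr; ring.
have zM : z ^+ M = 1.
  rewrite -expj_mulrn -(expj_2pi_int d); congr expj.
  by rewrite -[LHS]mulr_natr -[LHS]mulrA divfK.
rewrite /comb; case: ifPn => Md.
  have -> : z = 1.
    have /dvdzP[q dq] := Md.
    rewrite /z dq intrM; have -> : M%:~R = M%:R :> R by [].
    by rewrite mulfK// expj_2pi_int.
  under eq_bigr do rewrite expr1n.
  rewrite -qreal1 -qreal_sum sumr_const card_ord.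
  by congr qreal; rewrite -[RHS]mulr_natr mul1r.
have z1 : z != 1 by exact: expj_neq1.
(* Multiplicativity of [qabs] rules out zero divisors, so [z - 1] can be cancelled. *)
apply: qabs_eq0; have /(congr1 (@qabs R)) := subrX1 z M.
rewrite zM subrr qabsM -qreal0 qabs_real normr0 => /esym/eqP.
rewrite mulf_eq0 => /orP[|/eqP//] => /eqP/qabs_eq0/eqP.
by rewrite subr_eq0 (negbTE z1).
Qed.

(** [expi] and [expj] have the same cosine and sine components, so the real sums are read off
    [sum_expj]. *)
Lemma sum_expi (M : nat) (d : int) : (0 < M)%N ->
  \sum_(m < M) expi (2 * pi * ((m : nat)%:R / M%:R) * d%:~R) = qreal (comb M d).
Proof.
move=> M0; have /[dup] := sum_expj d M0.
move=> /(congr1 (@qre R)); rewrite (rlin_sum _ _ _ (@rlin_qre R))/= => sc.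
move=> /(congr1 (@qj R)); rewrite (rlin_sum _ _ _ (@rlin_qj R))/= => ss.
apply: eq_rlin => l ll; rewrite rlin_sum//.
under eq_bigr do rewrite (rlinE _ ll)/= !mulr0 !addr0.
by rewrite big_split/= -!mulr_sumr sc ss [RHS](rlinE _ ll)/= !mulr0 !addr0.
Qed.

Lemma qmul_pull_reals (u v : R) (x y y' x' : H) :
  x * qreal u * y * (y' * (qreal v * x')) = qreal (u * v) * (x * (y * y') * x').
Proof.
rewrite qrealM (qreal_comm u x) -(qreal_comm v x') !mulrA (qreal_comm v).
by rewrite (qreal_comm v (qreal u)) !mulrA.
Qed.

(** Conjugation reverses products, so the two [expj] factors meet in the middle, up to real window
    values, which are central. Summing over [m.2] first makes the middle real; then the outer [expi]
    factors merge as well. *)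
Lemma sum_modulation (M : nat) (k k' : Z2) (u v : R) : (0 < M)%N ->
  \sum_(m : N2 M)
    expi (2 * pi * ((m.1 : nat)%:R / M%:R) * k.1%:~R) * qreal u *
    expj (2 * pi * ((m.2 : nat)%:R / M%:R) * k.2%:~R) *
    qconj (expi (2 * pi * ((m.1 : nat)%:R / M%:R) * k'.1%:~R) * qreal v *
           expj (2 * pi * ((m.2 : nat)%:R / M%:R) * k'.2%:~R)) =
  qreal (comb M (k.1 - k'.1) * comb M (k.2 - k'.2) * (u * v)).
Proof.
move=> M0; pose th (m : 'I_M) : R := 2 * pi * ((m : nat)%:R / M%:R).
have thB m (a b : int) : th m * a%:~R - th m * b%:~R = th m * (a - b)%:~R.
  by rewrite intrB mulrBr.
transitivity (\sum_(m1 < M) \sum_(m2 < M)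
    qreal (u * v) * (expi (th m1 * k.1%:~R) *
     expj (th m2 * (k.2 - k'.2)%:~R) * expi (- (th m1 * k'.1%:~R)))).
  rewrite pair_bigA; apply: eq_bigr => -[m1 m2] _ /=.
  rewrite !qconjM qconj_expi qconj_expj -/(th m1) -/(th m2) -thB expjD.
  have -> : qconj (qreal v) = qreal v by rewrite /qconj /= oppr0.
  exact: qmul_pull_reals.
under eq_bigr => m1 _ do rewrite -mulr_sumr -mulr_suml -mulr_sumr sum_expj//
  qreal_comm -mulrA -expiD thB.
rewrite -mulr_sumr -mulr_sumr sum_expi// -!qrealM; congr qreal; ring.
Qed.

End Characters.

(** * Multiples and residues in Z^2 *)

Section IntegerLattice.
Local Set Implicit Arguments.
Local Unset Strict Implicit.

Lemma mulrn_Z2 (p : Z2) n : p *+ n = (p.1 *+ n, p.2 *+ n).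
Proof. by elim: n => // n IH; rewrite !mulrS IH. Qed.

Lemma mulrn_Z2_eq0 (M : nat) (p : Z2) : (0 < M)%N -> (p *+ M == 0) = (p == 0).
Proof.
move=> M0; rewrite mulrn_Z2; case: p => a b.
by rewrite !xpair_eqE !mulrn_eq0 (gtn_eqF M0).
Qed.

Lemma N2_decomposition (N : nat) (k : Z2) : (0 < N)%N ->
  exists (k0 : N2 N) (r : Z2), k = N2_to_Z2 k0 + r *+ N.
Proof.
move=> N0.
have dec (a : int) : exists (a0 : 'I_N) (b : int), a = Posz a0 + b *+ N.
  have aN : (`|(a %% N)%Z| < N)%N.
    by rewrite -ltz_nat gez0_abs ?modz_ge0 ?ltz_pmod// -lt0n.
  exists (Ordinal aN), (a %/ N)%Z => /=.
  rewrite gez0_abs ?modz_ge0 -?lt0n// pmulrn mulrzz addrC.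
  exact: divz_eq.
have [a0 [a ea]] := dec k.1; have [b0 [b eb]] := dec k.2.
by exists (a0, b0), (a, b); rewrite mulrn_Z2 [LHS]surjective_pairing ea eb.
Qed.

End IntegerLattice.

(** * Gabor series on point masses and on l2 *)

Section GaborDuality.
Local Set Implicit Arguments.
Local Unset Strict Implicit.
Local Open Scope classical_set_scope.
Variables (R : realType) (L M N : nat).
Local Notation H := (quat R).
Implicit Types (f phi : Z2 -> H) (g h : 'I_L -> Z2 -> H) (k p n : Z2).

Lemma shift_bij (c : Z2) : bijective (fun k : Z2 => k - c).
Proof. by exists (fun k => k + c) => k; rewrite ?subrK ?addrK. Qed.

Lemma l2_gabor g (l : 'I_L) n (m : N2 M) : l2 (g l) -> l2 (gabor N g l n m).
Proof.
rewrite /l2 /summable => sg.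
have := shift_bij (n *+ N); rewrite -setTT_bijective => bs.
rewrite (reindex_esum _ _ _ _ bs) in sg; apply: le_lt_trans sg.
rewrite le_eqVlt; apply/orP; left; apply/eqP/eq_esum => k _.
by rewrite /gabor /modulation !qabsM qabs_expi qabs_expj mul1r mulr1.
Qed.

(** For fixed [n] the sums over [l] and [m] are finite, so the term inherits the coordinatewise form
    of an inner product with an l2 sequence. *)
Lemma gabor_term_functionalr c g h f n : rlin c -> l2 f ->
  (forall l, l2 (h l)) ->
  exists lam, l2_functional
    (fun phi => c (\sum_(l < L) gabor_term M N g h f phi l n)) lam.
Proof.
move=> cl sf sh; eexists.
have -> : (fun phi => c (\sum_(l < L) gabor_term M N g h f phi l n)) =
  fun phi => \sum_(l < L) \sum_(m : N2 M)
    c (inner f (gabor N g l n m) * inner (gabor N h l n m) phi).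
  apply/funext => phi; rewrite rlin_sum//; apply: eq_bigr => l _.
  by rewrite /gabor_term rlin_sum.
apply: l2_functional_sum => l; apply: l2_functional_sum => m.
apply: (l2_functional_innerr (l := fun x => c (inner f (gabor N g l n m) * x))).
  exact: rlin_mull.
exact: l2_gabor.
Qed.

Lemma gabor_term_functionall c g h phi n : rlin c -> l2 phi ->
  (forall l, l2 (g l)) ->
  exists lam, l2_functional
    (fun f => c (\sum_(l < L) gabor_term M N g h f phi l n)) lam.
Proof.
move=> cl sphi sg; eexists.
have -> : (fun f => c (\sum_(l < L) gabor_term M N g h f phi l n)) =
  fun f => \sum_(l < L) \sum_(m : N2 M)
    c (inner f (gabor N g l n m) * inner (gabor N h l n m) phi).
  apply/funext => f; rewrite rlin_sum//; apply: eq_bigr => l _.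
  by rewrite /gabor_term rlin_sum.
apply: l2_functional_sum => l; apply: l2_functional_sum => m.
apply: (l2_functional_innerl (l := fun x => c (x * inner (gabor N h l n m) phi))).
  exact: rlin_mulr.
exact: l2_gabor.
Qed.

(** Moves the finite sum over [l] inside the series over [n]: duality concerns all windows together,
    so the exchange must be applied to this single series. *)
Lemma rlin_gabor_series c g h f phi : rlin c -> gabor_series_converge M N g h ->
  l2 f -> l2 phi ->
  rsummable (fun n => c (\sum_(l < L) gabor_term M N g h f phi l n)) /\
  c (\sum_(l < L) qsum (gabor_term M N g h f phi l)) =
  rsum (fun n => c (\sum_(l < L) gabor_term M N g h f phi l n)).
Proof.
move=> cl conv sf sphi.
have s l c' : rlin c' -> rsummable (c' \o gabor_term M N g h f phi l).
  by move=> cl'; apply: rsummable_rlin => //; exact: conv.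
under [X in rsummable X]eq_fun do rewrite rlin_sum//.
under [X in _ = rsum X]eq_fun do rewrite rlin_sum//.
split; first by apply: rsummable_sum => l; exact: (s l c).
rewrite rsum_sum => [|l]; last exact: (s l c).
by rewrite rlin_sum//; apply: eq_bigr => l _; rewrite rlin_qsum// => c'; exact: s.
Qed.

(** [l2_functional_exchange] is applied twice, first in [phi] with [f] a point mass, then in [f]
    with [phi] fixed in l2. *)
Lemma gabor_duality_of_deltas g h :
  (forall l, l2 (g l)) -> (forall l, l2 (h l)) -> gabor_series_converge M N g h ->
  (forall k k' x y, inner (delta k x) (delta k' y) =
     \sum_(l < L) qsum (gabor_term M N g h (delta k x) (delta k' y) l)) ->
  dual_gabor M N g h.
Proof.
move=> sg sh conv dd; split => // f phi sf sphi; apply: eq_rlin => c cl.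
have [_ ->] := rlin_gabor_series cl conv sf sphi; apply: esym.
have Tsum f' phi' : l2 f' -> l2 phi' ->
    rsummable (fun n => c (\sum_(l < L) gabor_term M N g h f' phi' l n)).
  by move=> sf' sphi'; have [] := rlin_gabor_series cl conv sf' sphi'.
have step k x phi' : l2 phi' ->
    rsum (fun n => c (\sum_(l < L) gabor_term M N g h (delta k x) phi' l n)) =
    c (inner (delta k x) phi').
  have [lam Hlam] := choice (fun n =>
    gabor_term_functionalr g n cl (l2_delta k x) sh).
  move: phi'; apply: (l2_functional_exchange Hlam).
  - exact: (l2_functional_innerr cl (l2_delta k x)).
  - by move=> phi'; apply: Tsum; exact: l2_delta.
  - move=> k' y; rewrite dd.
    by have [_ ->] := rlin_gabor_series cl conv (l2_delta k x) (l2_delta k' y).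
have [lam Hlam] := choice (fun n => gabor_term_functionall h n cl sphi sg).
move: f sf; apply: (l2_functional_exchange Hlam).
- exact: (l2_functional_innerl cl sphi).
- by move=> f' sf'; exact: Tsum.
- by move=> k x; exact: step.
Qed.

Lemma gabor_term_delta g h k k' x y l n : (0 < M)%N ->
  (forall l k, exists a, g l k = qreal a) -> (forall l k, exists a, h l k = qreal a) ->
  gabor_term M N g h (delta k x) (delta k' y) l n =
  qconj x * qreal (comb R M (k.1 - k'.1) * comb R M (k.2 - k'.2) *
    (qre (g l (k - n *+ N)) * qre (h l (k' - n *+ N)))) * y.
Proof.
move=> M0 rg rh.
have gE : g l (k - n *+ N) = qreal (qre (g l (k - n *+ N))).
  by have [a ->] := rg l (k - n *+ N).
have hE : h l (k' - n *+ N) = qreal (qre (h l (k' - n *+ N))).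
  by have [a ->] := rh l (k' - n *+ N).
rewrite /gabor_term -sum_modulation// mulr_sumr mulr_suml.
apply: eq_bigr => m _; rewrite inner_deltal inner_deltar.
by rewrite /gabor /modulation /translation gE hE !mulrA.
Qed.

Lemma comb_cong k p : comb R M (k.1 - (k + p *+ M).1) * comb R M (k.2 - (k + p *+ M).2)
  = M%:R ^+ 2.
Proof.
have d (a b : int) : comb R M (a - (a + b *+ M)) = M%:R.
  rewrite /comb opprD addrA subrr add0r.
  by rewrite rpredN pmulrn mulrzz dvdz_mull.
by rewrite mulrn_Z2 /= !d expr2.
Qed.

Lemma comb_incong k k' : (forall p, k' <> k + p *+ M) ->
  comb R M (k.1 - k'.1) * comb R M (k.2 - k'.2) = 0.
Proof.
move=> kk'; rewrite /comb; case: ifPn; last by rewrite mul0r.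
(* When both factors are nonzero, [M] divides the coordinates of [k - k']; passing to [k' - k]
   changes the signs of the quotients. *)
case: ifPn; last by rewrite mulr0.
move=> /dvdzP[b eb] /dvdzP[a ea]; exfalso; apply: (kk' (- a, - b)).
rewrite [LHS]surjective_pairing mulrn_Z2 /= !mulNrn !pmulrn !mulrzz -ea -eb.
by rewrite !opprB; case: k {kk' ea eb} => ? ? /=; congr pair; rewrite /= addrC subrK.
Qed.

Lemma inner_delta_delta k k' (x y : H) :
  inner (delta k x) (delta k' y) = qconj x * qreal (k' == k)%:R * y.
Proof.
rewrite inner_deltal /delta eq_sym.
by case: eqP => _; rewrite ?mulr1 ?qreal0 ?mulr0 ?mul0r.
Qed.

(** The second point [k'] is left free so that both points can be shifted together by a multiple of
    [N]. *)
Definition correlation g h k k' : R :=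
  \sum_(l < L) rsum (fun n => qre (g l (k - n *+ N)) * qre (h l (k' - n *+ N))).

Lemma correlation_imx g h k p :
  (forall l k, exists a, g l k = qreal a) -> (forall l k, exists a, h l k = qreal a) ->
  \sum_(l < L) imx_mul (gabor_mx M N (g l) k) (imx_tr (gabor_mx M N (h l) k)) 0 p =
  qreal (correlation g h k (k + p *+ M)).
Proof.
move=> rg rh; rewrite /correlation qreal_sum; apply: eq_bigr => l _.
rewrite -qsum_real /imx_mul; congr qsum; apply/funext => n.
rewrite /gabor_mx /imx_tr mul0rn addr0 qrealM; congr (_ * _).
  by have [a ->] := rg l (k - n *+ N).
by have [a ->] := rh l (k + p *+ M - n *+ N).
Qed.

(** A common shift by [r *+ N] is absorbed by reindexing the sum over [n]. *)
Lemma correlation_shift g h k k' r :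
  correlation g h (k + r *+ N) (k' + r *+ N) = correlation g h k k'.
Proof.
apply: eq_bigr => l _; rewrite -[RHS](reindex_rsum _ (shift_bij r)).
congr rsum; apply/funext => n /=.
by rewrite mulrnBl !opprB !addrA [k + _ - _]addrAC [k' + _ - _]addrAC.
Qed.

Lemma series_gabor_delta g h k x p y : (0 < M)%N ->
  (forall l k, exists a, g l k = qreal a) -> (forall l k, exists a, h l k = qreal a) ->
  gabor_series_converge M N g h ->
  \sum_(l < L) qsum (gabor_term M N g h (delta k x) (delta (k + p *+ M) y) l) =
  qconj x * qreal (M%:R ^+ 2 * correlation g h k (k + p *+ M)) * y.
Proof.
move=> M0 rg rh conv.
have termE x' y' l : gabor_term M N g h (delta k x') (delta (k + p *+ M) y') l =
   fun n => qconj x' * qreal (M%:R ^+ 2 * (qre (g l (k - n *+ N)) *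
      qre (h l (k + p *+ M - n *+ N)))) * y'.
  by apply/funext => n; rewrite gabor_term_delta// comb_cong.
(* Point masses of value 1 turn the assumed convergence into summability of the correlation terms,
   up to the nonzero factor [M%:R ^+ 2]. *)
have s l : rsummable (fun n => M%:R ^+ 2 * (qre (g l (k - n *+ N)) *
    qre (h l (k + p *+ M - n *+ N)))).
  have := conv _ _ (l2_delta k 1) (l2_delta (k + p *+ M) 1) l.
  move=> /(rsummable_rlin (@rlin_qre R)); rewrite termE.
  have -> : qconj (1 : H) = 1 by rewrite /qconj /= oppr0.
  set F := (X in _ -> rsummable X); rewrite (_ : _ \o _ = F)//.
  by apply/funext => n; rewrite /comp mul1r mulr1.
have M2 : M%:R ^+ 2 != 0 :> R by rewrite expf_neq0// pnatr_eq0 -lt0n.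
have s' l : rsummable (fun n => qre (g l (k - n *+ N)) *
    qre (h l (k + p *+ M - n *+ N))).
  have := rsummableZ (M%:R ^+ 2)^-1 (s l).
  by under eq_fun do rewrite mulrA mulVf// mul1r.
have mid c a : rlin c -> c (qconj x * qreal a * y) = a * c (qconj x * y).
  by move=> [_ cZ]; rewrite qreal_comm -mulrA cZ.
apply: eq_rlin => c cl; rewrite mid// rlin_sum// /correlation !mulr_sumr mulr_suml.
have compE c' l : rlin c' ->
    c' \o gabor_term M N g h (delta k x) (delta (k + p *+ M) y) l =
    fun n => M%:R ^+ 2 * c' (qconj x * y) *
      (qre (g l (k - n *+ N)) * qre (h l (k + p *+ M - n *+ N))).
  by move=> cl'; apply/funext => n; rewrite termE /= mid//; ring.
apply: eq_bigr => l _; rewrite rlin_qsum => // [|c' cl'].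
  by rewrite compE// rsumZ// mulrAC.
by rewrite compE//; exact: rsummableZ.
Qed.

End GaborDuality.

Theorem theorem7 (R : realType) (L M N : nat)
    (hL : (0 < L)%N) (hM : (0 < M)%N) (hN : (0 < N)%N)
    (g h : 'I_L -> Z2 -> quat R)
    (hg : forall l, l2_real (g l)) (hh : forall l, l2_real (h l))
    (hconv : gabor_series_converge M N g h) :
  dual_gabor M N g h <->
  (forall (k : N2 N) (p : Z2),
     \sum_(l < L) imx_mul (gabor_mx M N (g l) (N2_to_Z2 k))
                          (imx_tr (gabor_mx M N (h l) (N2_to_Z2 k))) 0 p
     = qreal ((M%:R ^+ 2)^-1 * (p == 0)%:R)).
Proof.
have sg l : l2 (g l) by case: (hg l).
have sh l : l2 (h l) by case: (hh l).
have rg l k : exists a, g l k = qreal a by case: (hg l).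
have rh l k : exists a, h l k = qreal a by case: (hh l).
have M2 : M%:R ^+ 2 != 0 :> R by rewrite expf_neq0// pnatr_eq0 -lt0n.
have shift0 (k p : Z2) : (k + p *+ M == k) = (p == 0).
  by rewrite -subr_eq0 addrAC subrr add0r mulrn_Z2_eq0.
split => [[_ dual] k p|corr].
  rewrite correlation_imx//; congr qreal.
  set k1 := N2_to_Z2 k.
  have := dual _ _ (l2_delta k1 1) (l2_delta (k1 + p *+ M) 1).
  rewrite series_gabor_delta// inner_delta_delta shift0.
  rewrite (_ : qconj (1 : quat R) = 1); last by rewrite /qconj /= oppr0.
  by rewrite !mul1r !mulr1 => -[->]; rewrite mulKf.
apply: gabor_duality_of_deltas => // k k' x y.
rewrite inner_delta_delta.
(* For congruent points the matrix condition applies; otherwise every term over [n] vanishes, and so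
   does the inner product because the points differ. *)
have [[p ->]|np] := pselect (exists p, k' = k + p *+ M).
  rewrite series_gabor_delta// shift0; congr (_ * qreal _ * _).
  (* Periodicity brings [k] back to a representative [k0], where the condition is assumed. *)
  have [k0 [r ->]] := N2_decomposition k hN.
  rewrite addrAC correlation_shift.
  have := corr k0 p; rewrite correlation_imx// => -[->].
  by rewrite mulVKf.
have k'k : k' != k.
  by apply/eqP => k'k; apply: np; exists 0; rewrite mul0rn addr0.
rewrite (negbTE k'k) qreal0 mulr0 mul0r big1// => l _.
have -> : gabor_term M N g h (delta k x) (delta k' y) l = fun=> qreal 0.
  apply/funext => n; rewrite gabor_term_delta// comb_incong ?mul0r.
    by rewrite qreal0 mulr0 mul0r.
  by move=> p kp; apply: np; exists p.
by rewrite qsum_real rsum0.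
Qed.
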